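(* Let $n\ge 3$ and consider the cycle graph on nodes $1,\dots,n$ with arbitrary measurements $\widetilde{R}_{12},\dots,\widetilde{R}_{n-1,n},\widetilde{R}_{n1}\in\mathrm{SO}(3)$, and let $\gamma\in[-\pi,\pi]$ be the rotation angle of the cycle error $E$. Then the set of eigenvalues of $\widetilde{R}$ is $$\sigma(\widetilde{R})=\big\{1+2\cos(\gamma/n-2k\pi/n)\big\}_{k=0,\dots,n-1}\ \cup\ \big\{1+2\cos(2k\pi/n)\big\}_{k=0,\dots,n-1}.$$
   Context: Cycle-graph setup: nodes $1,\dots,n$ ($n\ge3$), edges $\{i,i+1\}$ for $i=1,\dots,n-1$ and $\{n,1\}$; write $i\sim j$ for an edge. Measurements $\widetilde{R}_{ij}\in\mathrm{SO}(3)$ on edges with $\widetilde{R}_{ji}=\widetilde{R}_{ij}^\top$. The symmetric $3n\times3n$ block matrix $\widetilde{R}$ has $(i,j)$ $3\times3$ block $I_3$ if $i=j$, $\widetilde{R}_{ij}$ if $i\sim j$, and $0$ otherwise. The cycle error is $E:=\widetilde{R}_{12}\widetilde{R}_{23}\cdots\widetilde{R}_{n-1,n}\widetilde{R}_{n1}\in\mathrm{SO}(3)$ (product left to right), and $\gamma=\angle(E)\in[-\pi,\pi]$ is its rotation angle, i.e. $E=\exp(\gamma[\hat n]_\times)$ for a unit axis $\hat n$. *)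

(* Defs.v *)
From HB Require Import structures.
From mathcomp Require Import all_boot all_order all_algebra.
From mathcomp Require Import all_classical all_reals all_analysis.
Set Implicit Arguments. Unset Strict Implicit. Unset Printing Implicit Defensive.
Import Order.TTheory GRing.Theory Num.Theory.
Local Open Scope ring_scope.

(* Nodes are 0-indexed: paper node i+1 <-> index i.  Measurements are given as
   Rt : nat -> 'M_3 with Rt i = tilde R_{i+1,i+2} for i < n-1 and
   Rt (n-1) = tilde R_{n,1}.  Values of Rt at i >= n are irrelevant. *)

Definition is_SO3 (R : realType) (A : 'M[R]_3) : Prop :=
  A^T *m A = 1%:M /\ \det A = 1.

Definition cycle_block (R : realType) (n : nat) (Rt : nat -> 'M[R]_3)
  (p q : nat) : 'M[R]_3 :=
  if p == q then 1%:M
  else if q == (p.+1 %% n)%N then Rt p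
  else if p == (q.+1 %% n)%N then (Rt q)^T
  else 0.

Definition cycle_mx (R : realType) (n : nat) (Rt : nat -> 'M[R]_3)
  : 'M[R]_(3 * n) :=
  \matrix_(i < 3 * n, j < 3 * n)
    cycle_block n Rt (i %/ 3)%N (j %/ 3)%N (inord (i %% 3)) (inord (j %% 3)).

Definition cycle_error (R : realType) (n : nat) (Rt : nat -> 'M[R]_3) : 'M[R]_3 :=
  \prod_(i < n) Rt i.

Definition skew (R : realType) (u : 'cV[R]_3) : 'M[R]_3 :=
  \matrix_(i < 3, j < 3)
    nth 0 (nth [::]
      [:: [:: 0; - u (inord 2) 0; u (inord 1) 0];
          [:: u (inord 2) 0; 0; - u (inord 0) 0];
          [:: - u (inord 1) 0; u (inord 0) 0; 0]] i) j.

(* exp(g [u]_x) for a unit axis u, via Rodrigues' closed form. *)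
Definition rot_exp (R : realType) (g : R) (u : 'cV[R]_3) : 'M[R]_3 :=
  1%:M + sin g *: skew u + (1 - cos g) *: (skew u *m skew u).

Definition is_unit_axis (R : realType) (u : 'cV[R]_3) : Prop :=
  (u^T *m u) 0 0 = 1.

(* Main.v *)
(* Gauging by partial products of the measurements turns an eigenvector into a
   sequence of rows with [w q + w q.+2 = mu *: w q.+1], [mu = lambda - 1], twisted
   by [w (q + n) = w q *m E^T].  Comparing norms gives [|mu| <= 2], so
   [mu = 2 cos t], and the Chebyshev recurrence for [cos (m t)] yields
   [w (q + 2n) + w q = 2 cos (n t) w (q + n)], that is,
   [w q *m (E + E^T) = 2 cos (n t) w q].  By Rodrigues' formula [E + E^T] has
   eigenvalue 2 on the axis and [2 cos gamma] on its orthogonal complement, which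
   forces [cos (n t)] to be 1 or [cos gamma].  Conversely, [w q = cos (q t) u^T]
   and the rotating vector [cos (q t) a - sin (q t) (a *m skew u)], with [a]
   orthogonal to [u], solve the twisted recurrence for those [t]. *)
Require Import Defs.
From HB Require Import structures.
From mathcomp Require Import all_boot all_order all_algebra.
From mathcomp Require Import all_classical all_reals all_analysis.
From mathcomp Require Import ring lra zify.
Import Order.TTheory GRing.Theory Num.Theory.
Local Open Scope ring_scope.

(** * Periods and level sets of the cosine *)

Lemma cosDint {R : realType} (x : R) (k : int) :
  cos (x + 2 * k%:~R * pi) = cos x.
Proof.
have H (m : nat) y : cos (y + 2 * m%:R * pi) = cos y :> R.
  elim: m y => [|m IH] y; first by rewrite mulr0 mul0r addr0.
  rewrite -[RHS]IH -[RHS]cosD2pi; congr cos.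
  by rewrite -natr1; ring.
case: k => m; first exact: H.
by rewrite -[LHS](H m.+1) NegzE mulrNz -pmulrn; congr cos; ring.
Qed.

Lemma sinDint {R : realType} (x : R) (k : int) :
  sin (x + 2 * k%:~R * pi) = sin x.
Proof. by rewrite -!cosBpihalf addrAC cosDint. Qed.

(** Reduce [x] modulo 2 pi to some [y] between 0 and 2 pi. Injectivity of cosine between 0 and pi
    gives [y] or [2 * pi - y] equal to the absolute value of [g]; the sign [s] combines this
    reflection with the sign of [g]. *)
Lemma cos_eq_cos {R : realType} (x g : R) : - pi <= g <= pi -> cos x = cos g ->
  exists (s : bool) (k : int), x = (-1) ^+ s * g + 2 * k%:~R * pi.
Proof.
move=> gpi cxg; have pi0 := pi_gt0 R.
have cg : cos `|g| = cos g by rewrite cos_norm.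
have ag : `|g| \in `[0, pi] by rewrite in_itv /= normr_ge0 ler_norml.
have [s0 s0g] : exists s0 : bool, `|g| = (-1) ^+ s0 * g.
  case: (ger0P g) => _; [exists false|exists true];
    by rewrite ?expr0 ?expr1 ?mul1r ?mulN1r.
pose k := Num.floor (x / (2 * pi)).
have /andP[] := floor_itv (x / (2 * pi)); rewrite -/k => k1 k2.
rewrite ler_pdivlMr in k1; last lra.
rewrite ltr_pdivrMr in k2; last lra.
rewrite intrD in k2.
pose y := x - 2 * k%:~R * pi.
have cy : cos y = cos `|g|.
  by rewrite cg -cxg -[LHS](cosDint _ k); congr cos; rewrite /y; ring.
have y0 : 0 <= y by rewrite /y; nra.
have y2 : y < 2 * pi by rewrite /y; nra.
have xy : x = y + 2 * k%:~R * pi by rewrite /y; ring.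
have [yp|yp] := leP y pi.
  have yg : y = `|g| by apply: cos_inj => //; rewrite in_itv /= y0.
  by exists s0, k; rewrite xy yg s0g.
have yg : 2 * pi - y = `|g|.
  apply: cos_inj => //; first by rewrite in_itv /=; lra.
  rewrite -cy -[RHS]cosN -[RHS]cosD2pi; congr cos; ring.
exists (~~ s0), (k + 1); rewrite xy intrD.
have -> : y = 2 * pi - `|g| by rewrite -yg; ring.
by rewrite s0g signrN; ring.
Qed.

(** Moving [k] by a multiple of [n] moves the angle by a multiple of 2 pi, so the residue of [k]
    serves as index. *)
Lemma cos_shift_mod {R : realType} (n : nat) (g : R) (k : int) : (0 < n)%N ->
  exists j : 'I_n, cos (g / n%:R - 2 * k%:~R * pi / n%:R)
    = cos (g / n%:R - 2 * j%:R * pi / n%:R).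
Proof.
move=> n0; have nR : n%:R != 0 :> R by rewrite pnatr_eq0 -lt0n.
have nz : (n%:Z != 0) by lia.
have jge : 0 <= (k %% n%:Z)%Z by apply: modz_ge0.
have jn : (`|(k %% n%:Z)%Z|%N < n)%N by have := ltz_pmod k (d := n%:Z); lia.
exists (Ordinal jn) => /=.
rewrite -[RHS](cosDint _ (- (k %/ n%:Z)%Z)); congr cos.
have -> : k%:~R = (k %/ n%:Z)%Z%:~R * n%:R + `|(k %% n%:Z)%Z|%N%:R :> R.
  by rewrite {1}(divz_eq k n%:Z) intrD intrM !pmulrn gez0_abs.
by rewrite mulrNz; field.
Qed.

(** * Second-order recurrences with coefficient [2 * cos t] *)

Lemma cos_succ {R : realType} (t : R) (q : nat) :
  cos (q%:R * t) + cos (q.+2%:R * t) = 2 * cos t * cos (q.+1%:R * t).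
Proof.
have -> : q.+2%:R * t = q.+1%:R * t + t by rewrite -[q.+2%:R]natr1; ring.
have -> : q%:R * t = q.+1%:R * t - t by rewrite -[q.+1%:R]natr1; ring.
by rewrite cosB cosD; ring.
Qed.

Lemma sin_succ {R : realType} (t : R) (q : nat) :
  sin (q%:R * t) + sin (q.+2%:R * t) = 2 * cos t * sin (q.+1%:R * t).
Proof.
have -> : q.+2%:R * t = q.+1%:R * t + t by rewrite -[q.+2%:R]natr1; ring.
have -> : q%:R * t = q.+1%:R * t - t by rewrite -[q.+1%:R]natr1; ring.
by rewrite sinB sinD; ring.
Qed.

(** In terms of the shift T, the hypothesis reads T + T^-1 = 2 cos t, whence T^m + T^-m = 2 cos (m
    t). The induction carries two consecutive values of [m], because [cos (m t)] obeys a recurrence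
    of order two. *)
Lemma chebyshev_shift {R : realType} (t : R) (f : nat -> R) :
  (forall q, f q + f q.+2 = 2 * cos t * f q.+1) ->
  forall m q, f q + f (q + m.*2)%N = 2 * cos (m%:R * t) * f (q + m)%N.
Proof.
move=> rec m.
pose C k := forall q, f q + f (q + k.*2)%N = 2 * cos (k%:R * t) * f (q + k)%N.
suff [] : C m /\ C m.+1 by [].
elim: m => [|m [IH1 IH2]].
  split=> q; first by rewrite mul0r cos0 !addn0; ring.
  by rewrite mul1r addn1 addn2 rec.
split=> // q.
have cc : 2 * cos (m.+2%:R * t)
    = 2 * cos t * (2 * cos (m.+1%:R * t)) - 2 * cos (m%:R * t).
  by have := cos_succ t m; lra.
have r0 := rec q.
have r1 := rec (q + m.+1.*2)%N.
have r2 := IH1 q.+2.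
have r3 := IH2 q.+1.
have E1 : (q.+2 + m.*2 = q + m.+1.*2)%N by lia.
have E2 : (q.+1 + m.+1.*2 = (q + m.+1.*2).+1)%N by lia.
have E3 : (q + m.+2.*2 = (q + m.+1.*2).+2)%N by lia.
have E4 : (q.+2 + m = q + m.+2)%N by lia.
have E5 : (q.+1 + m.+1 = q + m.+2)%N by lia.
rewrite E1 E4 in r2; rewrite E2 E5 in r3; rewrite E3 cc.
(* Both sums on the right are centred at [q + m.+2], with half-widths [m.+1] and [m], so the two
   induction hypotheses apply. *)
have -> : f q + f (q + m.+1.*2).+2
    = 2 * cos t * (f q.+1 + f (q + m.+1.*2).+1) - (f q.+2 + f (q + m.+1.*2)%N).
  by rewrite mulrDr -r0 -r1; ring.
by rewrite r2 r3; ring.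
Qed.

(** * Skew matrices and rotations in dimension three *)

Lemma inord3 (i : 'I_3) : [\/ i = inord 0, i = inord 1 | i = inord 2].
Proof.
by case: i => [[|[|[|]]]] //= ?; [apply: Or31|apply: Or32|apply: Or33];
  apply/val_inj; rewrite /= inordK.
Qed.

Lemma sum3 (V : nmodType) (F : 'I_3 -> V) :
  \sum_i F i = F (inord 0) + F (inord 1) + F (inord 2).
Proof.
rewrite !big_ord_recl big_ord0 addr0 addrA.
by congr (F _ + F _ + F _); apply/val_inj; rewrite /= inordK.
Qed.

Lemma skew_sqr {R : realType} (u : 'cV[R]_3) :
  Defs.skew u *m Defs.skew u = u *m u^T - (u^T *m u) 0 0 *: 1%:M.
Proof.
apply/matrixP => i j; rewrite !mxE !sum3 big_ord1 !mxE.
by case: (inord3 i) => ->; case: (inord3 j) => ->;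
  rewrite -?val_eqE /= !inordK //=; ring.
Qed.

Lemma skew_mul {R : realType} (u : 'cV[R]_3) : Defs.skew u *m u = 0.
Proof.
apply/matrixP => i j; rewrite ord1 !mxE !sum3 !mxE.
by case: (inord3 i) => ->; rewrite !inordK //=; ring.
Qed.

Lemma skew_tr {R : realType} (u : 'cV[R]_3) : (Defs.skew u)^T = - Defs.skew u.
Proof.
apply/matrixP => i j; rewrite !mxE.
by case: (inord3 i) => ->; case: (inord3 j) => ->;
  rewrite !inordK //= ?oppr0 ?opprK.
Qed.

Lemma rot_exp_tr {R : realType} (g : R) (u : 'cV[R]_3) :
  (rot_exp g u)^T =
    1%:M - sin g *: Defs.skew u + (1 - cos g) *: (Defs.skew u *m Defs.skew u).
Proof.
rewrite /rot_exp !linearD /= !linearZ /= trmx1 trmx_mul skew_tr.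
by rewrite mulNmx mulmxN opprK scalerN.
Qed.

Lemma tr_axis_rot {R : realType} (g : R) (u : 'cV[R]_3) :
  u^T *m (rot_exp g u)^T = u^T.
Proof.
rewrite -trmx_mul /rot_exp !mulmxDl -!scalemxAl -mulmxA skew_mul mulmx0.
by rewrite !scaler0 !addr0 mul1mx.
Qed.

Lemma skew_sqr_perp {R : realType} (u : 'cV[R]_3) (a : 'rV[R]_3) :
  is_unit_axis u -> a *m u = 0 -> a *m Defs.skew u *m Defs.skew u = - a.
Proof.
move=> u1 au; rewrite -mulmxA skew_sqr u1 scale1r mulmxBr mulmxA au mul0mx.
by rewrite mulmx1 sub0r.
Qed.

(** On the plane orthogonal to the axis, [skew u] squares to -1, so it is a quarter turn and the
    addition formulas apply. *)
Lemma rot_perp {R : realType} (g s : R) (u : 'cV[R]_3) (a : 'rV[R]_3) :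
  is_unit_axis u -> a *m u = 0 ->
  (cos s *: a - sin s *: (a *m Defs.skew u)) *m (rot_exp g u)^T =
  cos (s + g) *: a - sin (s + g) *: (a *m Defs.skew u).
Proof.
move=> u1 au; have aK := skew_sqr_perp _ _ u1 au.
rewrite rot_exp_tr mulmxBl -!scalemxAl !mulmxDr !mulmx1 !mulmxN.
rewrite -!scalemxAr !mulmxA !aK mulNmx; move: (a *m _) => b.
rewrite cosD sinD; apply/rowP => j; rewrite !mxE; ring.
Qed.

(** Transposition negates only the sine term of Rodrigues' formula, which therefore cancels. *)
Lemma rot_add_tr {R : realType} (g : R) (u : 'cV[R]_3) : is_unit_axis u ->
  rot_exp g u + (rot_exp g u)^T
    = (2 * cos g)%:M + (2 - 2 * cos g) *: (u *m u^T).
Proof.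
move=> u1; rewrite rot_exp_tr /rot_exp skew_sqr u1 scale1r.
apply/matrixP => i j; rewrite !mxE; case: (i == j); rewrite ?mulr1n ?mulr0n; ring.
Qed.

Lemma exists_perp {R : fieldType} (u : 'cV[R]_3) :
  exists2 a : 'rV[R]_3, a != 0 & a *m u = 0.
Proof.
exists (nz_row (kermx u)); last first.
  by apply/sub_kermxP; exact: nz_row_sub.
rewrite nz_row_eq0 -mxrank_eq0 mxrank_ker subn_eq0 -ltnNge.
exact: leq_ltn_trans (rank_leq_col u) _.
Qed.

(** * Squared norms and the bound on [mu] *)

Definition sqn {R : realType} {m} (w : 'rV[R]_m) : R := (w *m w^T) 0 0.

Lemma sqnE {R : realType} {m} (w : 'rV[R]_m) : sqn w = \sum_j w 0 j ^+ 2.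
Proof. by rewrite /sqn mxE; apply: eq_bigr => j _; rewrite mxE. Qed.

Lemma sqn_ge0 {R : realType} {m} (w : 'rV[R]_m) : 0 <= sqn w.
Proof. by rewrite sqnE; apply: sumr_ge0 => j _; exact: sqr_ge0. Qed.

Lemma sqn_gt0 {R : realType} {m} (w : 'rV[R]_m) :
  (0 < sqn w) = (w != 0).
Proof.
rewrite lt_def sqn_ge0 andbT; congr (~~ _); rewrite sqnE psumr_eq0; last first.
  by move=> j _; rewrite sqr_ge0.
apply/allP/eqP => [H|-> j _]; last by rewrite mxE expr0n /= eqxx.
apply/rowP => j; rewrite mxE; apply/eqP.
by have := H j (mem_index_enum j); rewrite /= sqrf_eq0.
Qed.

Lemma sqnZ {R : realType} {m} (c : R) (w : 'rV[R]_m) :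
  sqn (c *: w) = c ^+ 2 * sqn w.
Proof. by rewrite !sqnE mulr_sumr; apply: eq_bigr => j _; rewrite mxE exprMn. Qed.

Lemma sqn_add {R : realType} {m} (v w : 'rV[R]_m) :
  sqn (v + w) <= 2 * sqn v + 2 * sqn w.
Proof.
rewrite !sqnE !mulr_sumr -big_split /=; apply: ler_sum => j _; rewrite mxE.
by have := sqr_ge0 (v 0 j - w 0 j); nra.
Qed.

Lemma sqn_orth {R : realType} {m} (w : 'rV[R]_m) (Q : 'M[R]_m) :
  Q *m Q^T = 1%:M -> sqn (w *m Q) = sqn w.
Proof. by move=> QQ; rewrite /sqn trmx_mul mulmxA -(mulmxA w) QQ mulmx1. Qed.

(* Compare the recurrence at an index where [sqn] is maximal. *)
Lemma rec_bound {R : realType} (m n : nat) (mu : R)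
    (w : nat -> 'rV[R]_m) (F : 'M[R]_m) :
  (0 < n)%N -> F *m F^T = 1%:M ->
  (forall q, w q + w q.+2 = mu *: w q.+1) ->
  (forall q, w (q + n)%N = w q *m F) ->
  (exists q, w q != 0) -> -2 <= mu <= 2.
Proof.
move=> n0 FF rec per [q0 wq0].
have wmod q : sqn (w q) = sqn (w (q %% n)%N).
  rewrite {1}(divn_eq q n); elim: (q %/ n)%N => [|k IH] //.
  by rewrite mulSn -addnA addnC per sqn_orth.
pose i0 : 'I_n := Ordinal n0.
pose i := [arg max_(i > i0) sqn (w i)]%O.
have imax q : sqn (w q) <= sqn (w i).
  rewrite wmod /i; case: arg_maxP => // k _ H.
  exact: (H (Ordinal (ltn_pmod q n0))).
have wi : 0 < sqn (w i) by apply: lt_le_trans (imax q0); rewrite sqn_gt0.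
(* The neighbours of the maximal index are taken one period later, since [i] may be 0. The middle
   term [w (i + n)] has the same norm as [w i]. *)
have := rec (i + n.-1)%N.
have -> : (i + n.-1).+1 = (i + n)%N by rewrite -addnS prednK.
rewrite per => /(congr1 (@sqn R m)); rewrite sqnZ sqn_orth // => H.
have := sqn_add (w (i + n.-1)%N) (w (i + n)%N.+1); rewrite H => H2.
have h1 := imax (i + n.-1)%N; have h2 := imax (i + n)%N.+1.
have : mu ^+ 2 * sqn (w i) <= 4 * sqn (w i) by lra.
by rewrite ler_pM2r // => m4; apply/andP; split; nra.
Qed.

(** * The eigenvalue equation in 3 by 3 blocks *)

Lemma sum_ord_mul {V : nmodType} (F : nat -> V) m n :
  \sum_(i < m * n) F i = \sum_(p < n) \sum_(j < m) F (m * p + j)%N.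
Proof.
rewrite -(big_mkord xpredT F).
elim: n => [|n IH]; first by rewrite muln0 big_geq // big_ord0.
rewrite big_ord_recr -IH /= mulnS addnC.
rewrite (@big_cat_nat _ _ _ (m * n)) ?leq_addr //=; congr (_ + _).
rewrite -{1}[(m * n)%N]add0n big_addn addKn big_mkord.
by apply: eq_bigr => j _; rewrite addnC.
Qed.

(* A row vector of length [3 n] is read as [n] rows of length 3. *)
Lemma eigenvalue_blocks {R : realType} (n : nat) (Rt : nat -> 'M[R]_3) (l : R) :
  eigenvalue (cycle_mx n Rt) l <->
  exists v : nat -> 'rV[R]_3, (exists2 q, (q < n)%N & v q != 0) /\
    forall q, (q < n)%N ->
      \sum_(p < n) v p *m cycle_block n Rt p q = l *: v q.
Proof.
(* Dictionary between flat and block coordinates, serving both directions of the equivalence. *)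
have key (x : 'rV[R]_(3 * n)) (v : nat -> 'rV[R]_3) :
    (forall i, x 0 i = v (i %/ 3)%N 0 (inord (i %% 3))) ->
    forall (q : nat) (j : 'I_3) (h : (3 * q + j < 3 * n)%N),
    (x *m cycle_mx n Rt) 0 (Ordinal h)
      = (\sum_(p < n) v p *m cycle_block n Rt p q) 0 j
    /\ x 0 (Ordinal h) = v q 0 j.
  move=> xv q j h.
  have dm (p : nat) (k : 'I_3) :
      ((3 * p + k) %/ 3 = p)%N /\ inord ((3 * p + k) %% 3) = k :> 'I_3.
    have := ltn_ord k; split; first by lia.
    by apply/val_inj; rewrite /= inordK; lia.
  split; last by rewrite xv /=; have [-> ->] := dm q j.
  rewrite mxE summxE.
  pose F (i : nat) := v (i %/ 3)%N 0 (inord (i %% 3)) *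
    cycle_block n Rt (i %/ 3)%N q (inord (i %% 3)) j.
  transitivity (\sum_(i < 3 * n) F i).
    by apply: eq_bigr => i _; rewrite xv mxE /=; have [-> ->] := dm q j.
  rewrite sum_ord_mul; apply: eq_bigr => p _; rewrite mxE.
  by apply: eq_bigr => k _; rewrite /F; have [-> ->] := dm p k.
split=> [/eigenvalueP[x xA x0]|[v [[q qn vq] vA]]].
  pose v (q : nat) : 'rV[R]_3 := \row_j
    if insub (3 * q + j)%N is Some i then x 0 i else 0.
  have xv i : x 0 i = v (i %/ 3)%N 0 (inord (i %% 3)).
    have iE : (3 * (i %/ 3) + i %% 3)%N = i by rewrite mulnC -divn_eq.
    rewrite mxE inordK ?ltn_mod // iE.
    by case: insubP => [i' _ /val_inj -> //|]; rewrite ltn_ord.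
  exists v; split.
    have [i xi] : exists i, x 0 i != 0.
      apply/existsP; apply: contra_neqT x0 => /existsPn H; apply/rowP => i.
      by rewrite mxE; apply/eqP; have := H i; rewrite negbK.
    exists (i %/ 3)%N; first by have := ltn_ord i; lia.
    by apply: contra_neq xi; rewrite xv => ->; rewrite mxE.
  move=> q qn; apply/rowP => j.
  have h : (3 * q + j < 3 * n)%N by have := ltn_ord j; lia.
  by have [<- H] := key x v xv q j h; rewrite xA !mxE; congr (_ * _); rewrite H mxE.
pose x : 'rV[R]_(3 * n) := \row_i v (i %/ 3)%N 0 (inord (i %% 3)).
have xv i : x 0 i = v (i %/ 3)%N 0 (inord (i %% 3)) by rewrite mxE.
apply/eigenvalueP; exists x.
  apply/rowP => i.
  have ij : (i = 3 * (i %/ 3) + (inord (i %% 3) : 'I_3) :> nat)%N.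
    by rewrite inordK ?ltn_mod //; lia.
  have in3 : (i %/ 3 < n)%N by have := ltn_ord i; lia.
  have h : (3 * (i %/ 3) + (inord (i %% 3) : 'I_3) < 3 * n)%N by rewrite -ij ltn_ord.
  have -> : i = Ordinal h by apply/val_inj; exact: ij.
  have [-> H] := key x v xv _ _ h.
  by rewrite vA // mxE [in RHS]mxE H.
apply: contra_neq vq => x0; apply/rowP => j.
have h : (3 * q + j < 3 * n)%N by have := ltn_ord j; lia.
by have [_ <-] := key x v xv q j h; rewrite x0 !mxE.
Qed.

(** As [n] is at least 3, a node and its two neighbours are distinct modulo [n], so three blocks of
    the column survive. Writing the column as [q.+1] avoids a predecessor modulo [n]. *)
Lemma cycle_block_sum {R : realType} (n : nat) (Rt : nat -> 'M[R]_3)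
    (v : nat -> 'rV[R]_3) (q : nat) : (3 <= n)%N ->
  \sum_(p < n) v p *m cycle_block n Rt p (q.+1 %% n)%N =
  v (q.+1 %% n)%N + v (q %% n)%N *m Rt (q %% n)%N
    + v (q.+2 %% n)%N *m (Rt (q.+1 %% n)%N)^T.
Proof.
move=> n3; have n0 : (0 < n)%N by lia.
pose o k : 'I_n := Ordinal (ltn_pmod k n0).
have S k : ((k %% n).+1 %% n = k.+1 %% n)%N by rewrite -[in LHS]addn1 modnDml addn1.
have Sinj a b : (a.+1 %% n = b.+1 %% n)%N -> (a %% n = b %% n)%N.
  by move=> /eqP; rewrite -(addn1 a) -(addn1 b) eqn_modDr => /eqP.
have ne j a : (0 < j < n)%N -> (a %% n != (a + j) %% n)%N.
  move=> /andP[j0 jn]; rewrite -[X in (X %% n)%N != _]addn0 eqn_modDl mod0n.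
  by rewrite (modn_small jn) eq_sym -lt0n.
have ne1 a : (a %% n != a.+1 %% n)%N by rewrite -addn1 ne // (ltnW n3).
have ne2 a : (a %% n != a.+2 %% n)%N by rewrite -addn2 ne // n3.
rewrite (bigD1 (o q.+1)) //= (bigD1 (o q)) /=; last by rewrite -val_eqE /=.
rewrite (bigD1 (o q.+2)) /=; last first.
  by rewrite -!val_eqE /= eq_sym ne1 eq_sym ne2.
rewrite big1 ?addr0; last first.
  move=> p; rewrite -!val_eqE /= => /andP[/andP[p1 p2] p3].
  rewrite /cycle_block (negbTE p1) S (negbTE p3) ifN ?mulmx0 //.
  apply: contra p2 => /eqP/Sinj ->; by rewrite modn_small.
rewrite /cycle_block eqxx mulmx1 (negbTE (ne1 _)) S eqxx -addrA.
rewrite eq_sym (negbTE (ne1 _)) !S eqxx ifN //.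
Qed.

(** * Gauging by partial products *)

Lemma periodic_modn {T : Type} (n : nat) (f : nat -> T) :
  (forall q, f (q + n)%N = f q) -> forall q, f (q %% n)%N = f q.
Proof.
move=> per q; rewrite [in RHS](divn_eq q n); elim: (q %/ n)%N => [|k IH] //.
by rewrite mulSn -addnA addnC per.
Qed.

Section Gauge.
Context {R : realType} (n : nat) (Rt : nat -> 'M[R]_3).
Context (n3 : (3 <= n)%N) (Rt_SO3 : forall i, (i < n)%N -> is_SO3 (Rt i)).

(** Reading the measurements cyclically lets the partial products continue past one turn. *)
Let S q := Rt (q %% n)%N.
Let P q : 'M[R]_3 := \prod_(i < q) S i.

Let S_orth q : S q *m (S q)^T = 1%:M.
Proof.
by have [SS _] := Rt_SO3 (q %% n)%N (ltn_pmod q (ltnW (ltnW n3))); apply: mulmx1C.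
Qed.

Let PS q : P q.+1 = P q *m S q.
Proof. by rewrite /P big_ord_recr mulmxE. Qed.

Let P_orth q : P q *m (P q)^T = 1%:M.
Proof.
elim: q => [|q IH]; first by rewrite /P big_ord0 trmx1 mulmx1.
by rewrite PS trmx_mul -mulmxA (mulmxA (S q)) S_orth mul1mx.
Qed.

Let P_orthC q : (P q)^T *m P q = 1%:M.
Proof. exact: mulmx1C. Qed.

Let Pn : P n = cycle_error n Rt.
Proof. by apply: eq_bigr => i _; rewrite /S modn_small. Qed.

Lemma cycle_error_orth : cycle_error n Rt *m (cycle_error n Rt)^T = 1%:M.
Proof. by rewrite -Pn. Qed.

Let P_shift q : P (q + n) = cycle_error n Rt *m P q.
Proof.
rewrite -Pn addnC /P big_split_ord mulmxE; congr (_ * _).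
by apply: eq_bigr => i _; rewrite /S /= modnDl.
Qed.

(* Substituting [v q = w q *m P q], with [P q] the product of the first [q]
   measurements, turns every measurement into the identity, except that the
   cycle error reappears when going once around the cycle. *)
Lemma eigenvalue_gauge (l : R) :
  eigenvalue (cycle_mx n Rt) l <->
  exists w : nat -> 'rV[R]_3,
    [/\ exists q, w q != 0,
        forall q, w q + w q.+2 = (l - 1) *: w q.+1
      & forall q, w (q + n)%N = w q *m (cycle_error n Rt)^T].
Proof.
have n0 : (0 < n)%N by lia.
rewrite eigenvalue_blocks; split=> [[v [[q qn vq] vA]]|[w [[q wq] rec per]]].
  exists (fun q => v (q %% n)%N *m (P q)^T); split.
  - exists q; rewrite modn_small //.
    apply: contra_neq vq => /(congr1 (mulmx^~ (P q))).
    by rewrite -mulmxA P_orthC mulmx1 mul0mx.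
  - move=> k; have := vA (k.+1 %% n)%N (ltn_pmod _ n0).
    rewrite cycle_block_sum // => /(congr1 (mulmx^~ (P k.+1)^T)).
    rewrite !mulmxDl -scalemxAl.
    have -> : v (k %% n)%N *m Rt (k %% n)%N *m (P k.+1)^T = v (k %% n)%N *m (P k)^T.
      by rewrite PS trmx_mul -mulmxA (mulmxA (Rt _)) (S_orth k) mul1mx.
    rewrite -mulmxA -trmx_mul -(PS k.+1) => H.
    by rewrite scalerBl scale1r -H [RHS]addrC -addrA addKr.
  - by move=> k; rewrite modnDr P_shift trmx_mul mulmxA.
pose v k := w k *m P k.
(* The twist of [w] by the transposed cycle error cancels the factor gained by [P] over one turn. *)
have vper k : v (k + n)%N = v k.
  by rewrite /v per P_shift -mulmxA (mulmxA _^T) (mulmx1C cycle_error_orth) mul1mx.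
exists v; split.
  exists (q %% n)%N; first exact: ltn_pmod.
  rewrite (periodic_modn _ _ vper).
  apply: contra_neq wq => /(congr1 (mulmx^~ (P q)^T)).
  by rewrite -mulmxA P_orth mulmx1 mul0mx.
move=> k kn; have -> : k = ((k + n.-1).+1 %% n)%N.
  by rewrite -addnS prednK // modnDr modn_small.
move: (k + n.-1)%N => {kn}k.
rewrite cycle_block_sum // !(periodic_modn _ _ vper).
have -> : v k *m Rt (k %% n)%N = w k *m P k.+1 by rewrite PS mulmxA.
have -> : v k.+2 *m (Rt (k.+1 %% n)%N)^T = w k.+2 *m P k.+1.
  by rewrite /v PS -!mulmxA (S_orth k.+1) mulmx1.
rewrite /v -addrA -mulmxDl rec -scalemxAl scalerBl scale1r.
by rewrite addrC subrK.
Qed.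

End Gauge.

(** * Solutions of the twisted recurrence *)

Lemma twisted_rec_cos {R : realType} (n : nat) (g mu : R) (u : 'cV[R]_3)
    (w : nat -> 'rV[R]_3) :
  (0 < n)%N -> is_unit_axis u -> rot_exp g u *m (rot_exp g u)^T = 1%:M ->
  (exists q, w q != 0) ->
  (forall q, w q + w q.+2 = mu *: w q.+1) ->
  (forall q, w (q + n)%N = w q *m (rot_exp g u)^T) ->
  exists2 t, mu = 2 * cos t & cos (n%:R * t) = cos g \/ cos (n%:R * t) = 1.
Proof.
move=> n0 u1 EE wn0 rec per.
have mu2 : -2 <= mu <= 2.
  apply: (rec_bound 3 n mu w (rot_exp g u)^T) => //.
  by rewrite trmxK; apply: mulmx1C.
pose t := acos (mu / 2).
have mut : mu = 2 * cos t by rewrite /t acosK ?in_itv /=; lra.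
exists t => //; set c := cos (n%:R * t).
have [q wq] := wn0.
have cheb : w q + w (q + n.*2)%N = (2 * c) *: w (q + n)%N.
  apply/rowP => j; rewrite !mxE.
  apply: (chebyshev_shift t (fun q => w q 0 j)) => k.
  by rewrite -mut; have /rowP/(_ j) := rec k; rewrite !mxE.
(* Multiplying by the rotation cancels one of the transposed rotations in each twisted term. *)
have wE : w q *m (rot_exp g u + (rot_exp g u)^T) = (2 * c) *: w q.
  have := congr1 (mulmx^~ (rot_exp g u)) cheb.
  rewrite -addnn addnA !per mulmxDl -scalemxAl -!mulmxA (mulmx1C EE) !mulmx1.
  by rewrite -mulmxDr.
rewrite rot_add_tr // mulmxDr mul_mx_scalar -scalemxAr mulmxA in wE.
set s := w q *m u in wE.
have [c1|c1] := eqVneq c 1; first by right.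
(* Multiplying [wE] by [u] gives [2 s = 2 c s], so [s] vanishes when [c] is not 1. Then [w q] is
   orthogonal to the axis and [wE] compares [c] with [cos g]. *)
left; have s0 : s = 0.
  have := congr1 (mulmx^~ u) wE.
  rewrite mulmxDl -!scalemxAl -/s -mulmxA [u^T *m u]mx11_scalar u1 mulmx1.
  rewrite -scalerDl addrCA subrr addr0 => /eqP.
  rewrite -subr_eq0 -scalerBl scaler_eq0.
  by move=> /orP[H|/eqP //]; case/eqP: c1; move/eqP: H; lra.
move: wE; rewrite s0 mul0mx scaler0 addr0 => /eqP.
rewrite -subr_eq0 -scalerBl scaler_eq0 (negbTE wq) orbF => /eqP; lra.
Qed.

Lemma twisted_rec_exists {R : realType} (n : nat) (g t : R) (u : 'cV[R]_3)
    (k : int) :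
  is_unit_axis u ->
  n%:R * t = g + 2 * k%:~R * pi \/ n%:R * t = 2 * k%:~R * pi ->
  exists w : nat -> 'rV[R]_3,
    [/\ exists q, w q != 0,
        forall q, w q + w q.+2 = (2 * cos t) *: w q.+1
      & forall q, w (q + n)%N = w q *m (rot_exp g u)^T].
Proof.
move=> u1; case=> nt; last first.
  exists (fun q => cos (q%:R * t) *: u^T); split.
  - exists 0; rewrite mul0r cos0 scale1r; apply/eqP => u0.
    by move/eqP: u1; rewrite u0 mul0mx mxE eq_sym oner_eq0.
  - by move=> q; rewrite -scalerDl cos_succ scalerA.
  - by move=> q; rewrite -scalemxAl tr_axis_rot natrD mulrDl nt cosDint.
have [a a0 au] := exists_perp u.
exists (fun q => cos (q%:R * t) *: a - sin (q%:R * t) *: (a *m Defs.skew u)); split.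
- by exists 0; rewrite mul0r cos0 sin0 scale1r scale0r subr0.
- move=> q; rewrite addrACA -opprD -!scalerDl cos_succ sin_succ.
  by rewrite scalerBr !scalerA.
- by move=> q; rewrite rot_perp // natrD mulrDl nt addrA cosDint sinDint.
Qed.

Theorem theorem3 (R : realType) (n : nat) (Rt : nat -> 'M[R]_3)
  (gamma : R) (u : 'cV[R]_3) :
  (3 <= n)%N ->
  (forall i, (i < n)%N -> is_SO3 (Rt i)) ->
  - pi <= gamma <= pi ->
  is_unit_axis u ->
  cycle_error n Rt = rot_exp gamma u ->
  forall lambda : R,
    eigenvalue (cycle_mx n Rt) lambda <->
    ((exists k : 'I_n,
        lambda = 1 + 2 * cos (gamma / n%:R - 2 * k%:R * pi / n%:R)) \/
     (exists k : 'I_n, lambda = 1 + 2 * cos (2 * k%:R * pi / n%:R))).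
Proof.
move=> n3 SO3 gpi u1 errE l; have n0 : (0 < n)%N by lia.
have nR : n%:R != 0 :> R by rewrite pnatr_eq0 -lt0n.
have EE := cycle_error_orth n Rt n3 SO3; rewrite errE in EE.
rewrite eigenvalue_gauge // errE; split.
  case=> w [wn0 rec per].
  have [t mut ct] := twisted_rec_cos n gamma _ u w n0 u1 EE wn0 rec per.
  have lt : l = 1 + 2 * cos t by lra.
  (* Divide [n t = g + 2 k pi] or [n t = - g + 2 k pi] by [n]; in the second case evenness of cosine
     allows passing to [- t], hence the sign in the index. It is applied with [g] equal to [gamma]
     and to 0. *)
  have index g : - pi <= g <= pi -> cos (n%:R * t) = cos g ->
      exists k : 'I_n, cos t = cos (g / n%:R - 2 * k%:R * pi / n%:R).
    move=> gi /(cos_eq_cos _ _ gi)[s [k ntk]].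
    have [j jE] := cos_shift_mod n g (- (-1) ^+ s * k) n0; exists j; rewrite -jE.
    have -> : t = (n%:R * t) / n%:R by field.
    rewrite ntk; case: (s); last first.
      by congr cos; rewrite expr0 mulN1r mulrNz; field.
    by rewrite -[LHS]cosN; congr cos; rewrite expr1 opprK mul1r; field.
  case: ct => ct.
    by have [k tk] := index _ gpi ct; left; exists k; rewrite lt tk.
  have [||k tk] := index 0; [by have := pi_gt0 R; lra | by rewrite ct cos0 |].
  by right; exists k; rewrite lt tk mul0r sub0r cosN.
case=> -[k ->].
  (* The integer is [- k] because here [n t = gamma - 2 k pi]. *)
  have [|w [wn0 rec per]] := twisted_rec_exists n gamma
    (gamma / n%:R - 2 * k%:R * pi / n%:R) u (- k%:Z) u1.
    by left; rewrite mulrNz -pmulrn; field.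
  by exists w; split=> // q; rewrite rec; congr (_ *: _); ring.
have [|w [wn0 rec per]] := twisted_rec_exists n gamma (2 * k%:R * pi / n%:R) u k u1.
  by right; rewrite -pmulrn; field.
by exists w; split=> // q; rewrite rec; congr (_ *: _); ring.
Qed.
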